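(* Let $p_1,p_2\in\mathbb{R}$ be two distinct numbers. Consider the following properties of a pair of functions $c_1,c_2:\mathbb{R}\to\mathbb{R}$. \begin{enumerate} \item The pair $(c_1,c_2)$ is admissible with $Z_{\rm F}=\{p_1,p_2\}$, and the images of $c_1$ and $c_2$ are both $\{x\in\mathbb{R}\mid p_1<x<p_2\}$ in the case $p_1<p_2$ and both $\{x\in\mathbb{R}\mid p_2<x<p_1\}$ in the case $p_1>p_2$. \item The set $S(c_1)$ is empty and the set $S(c_2)\subset\mathbb{R}$ is unbounded. \item Both $c_1(x)$ and $c_2(x)$ converge to $p_1$ as $x$ diverges to $-\infty$. \item Both $c_1(x)$ and $c_2(x)$ converge to $p_2$ as $x$ diverges to $+\infty$. \item The sets $S(c_1)\subset\mathbb{R}$ and $S(c_2)\subset\mathbb{R}$ are unbounded. \item The sets $S(c_1)\subset\mathbb{R}$ and $S(c_2)\subset\mathbb{R}$ are bounded below and unbounded above. \end{enumerate} Then there exist two globally similar real analytic functions $c_1,c_2$ with properties (1), (2), (3), (4). There also exist two globally similar real analytic functions $c_1,c_2$ with properties (1), (3), (4), (5). There also exist two globally similar real analytic functions $c_1,c_2$ with properties (1), (3), (4), (6).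
   Context: For a differentiable function $c$, $S(c)$ denotes its set of critical points. An $\mathbb{R}$-$\mathbb{R}$ TS function is a smooth function $c:\mathbb{R}\to\mathbb{R}$ whose critical set $S(c)$ is a disjoint union of finitely many (possibly none) or countably many sets each of which is a one-point set or a copy of $D^1=[-1,1]$, $\{t\ge0\}$, or $\mathbb{R}$. Admissibility: put $D_{c_1,c_2}:=\{(x_1,x_2)\in\mathbb{R}^2\mid c_1(x_2)<x_1<c_2(x_2)\}$ with closure $\overline{D_{c_1,c_2}}$ in $\mathbb{R}^2$, and $\pi_{2,1}(x_1,x_2)=x_1$. A contour of a function is a connected component of a level set. For a discrete closed subset $Z_{\rm F}\subset\mathbb{R}$, the pair $(c_1,c_2)$ is admissible with $Z_{\rm F}$ if: $c_1,c_2$ are $\mathbb{R}$-$\mathbb{R}$ TS functions with $c_1(x)<c_2(x)$ for all $x$; $(c_1(S(c_1))\cup c_2(S(c_2)))\cap(\mathbb{R}-Z_{\rm F})$ is discrete and closed in $\mathbb{R}-Z_{\rm F}$; and for each $p\in Z_{\rm F}$ and each contour $C_p$ of $\pi_{2,1}|_{\overline{D_{c_1,c_2}}}$ in the level set $\pi_{2,1}^{-1}(p)\cap\overline{D_{c_1,c_2}}$ there is a connected neighborhood $K(C_p)$ of $C_p$ in $\overline{D_{c_1,c_2}}$ which is a disjoint union of contours of $\pi_{2,1}|_{\overline{D_{c_1,c_2}}}$, is closed in $\overline{D_{c_1,c_2}}$, and is such that $K(C_p)-C_p$ contains no point $(c_i(x),x)$ with $i\in\{1,2\}$, $x\in S(c_i)$.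 Global similarity: two subsets of $\mathbb{R}^k$ are congruent if one is mapped onto the other by a composition of finitely many rotations, reflections and parallel translations. Graphs $\{(c_{0,1}(x),x)\mid x\in\mathbb{R}\}$ and $\{(c_{0,2}(x),x)\mid x\in\mathbb{R}\}$ of functions $c_{0,i}:\mathbb{R}\to\mathbb{R}$ (and the functions themselves) are globally similar if they are congruent, or if they are respectively congruent to graphs $\{(c_{1,1}(x),x)\mid x\in\mathbb{R}\}$ and $\{(c_{1,2}(x),x)\mid x\in\mathbb{R}\}$ of functions $c_{1,i}:\mathbb{R}\to\mathbb{R}$ with $c_{1,2}(x)=c_{1,1}(x)+p(x)$ for some smooth bounded function $p:\mathbb{R}\to\mathbb{R}$. *)

(* Defs.v *)
From mathcomp Require Export all_boot all_order all_algebra.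
From mathcomp Require Export all_classical all_reals all_analysis.

Set Implicit Arguments.
Unset Strict Implicit.
Unset Printing Implicit Defensive.

Export Order.TTheory GRing.Theory Num.Theory.
Export numFieldNormedType.Exports.

Local Open Scope classical_set_scope.
Local Open Scope ring_scope.

Definition discrete_set (T : topologicalType) (A : set T) : Prop :=
  A `<=` isolated A.

(* [subspace X] carries the subspace topology on X; its points outside X are
   isolated, so for A included in X this says that A is closed relative to X. *)
Definition closed_in (T : topologicalType) (X A : set T) : Prop :=
  A `<=` X /\ closed (A : set (subspace X)).

Section OneVariable.
Variable R : realType.
Implicit Types (c f : R -> R) (A B : set R).

Definition smooth f : Prop := forall n x, derivable (derive1n n f) x 1.

Definition real_analytic f : Prop :=
  forall x0, exists a : nat -> R, exists2 r : R, 0 < r &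
    forall x, `|x - x0| < r -> pseries a (x - x0) @ \oo --> f x.

Definition critical_set c : set R := [set x : R | is_derive x 1 c 0].

Definition homeomorphic A B : Prop :=
  exists f g : R -> R,
    [/\ f @` A = B, g @` B = A & {in A, cancel f g} /\ {in B, cancel g f}] /\
    ({within A, continuous f} /\ {within B, continuous g}).

Definition ts_piece A : Prop :=
  [\/ exists x, A = [set x],
      homeomorphic A `[-1, 1]%classic,
      homeomorphic A `[0, +oo[%classic |
      homeomorphic A setT].

(* [countable] includes the finite and the empty families. *)
Definition ts_function c : Prop :=
  smooth c /\
  exists F : set (set R),
    [/\ countable F, trivIset F id, F `<=` ts_piece &
        critical_set c = \bigcup_(A in F) A].

End OneVariable.

Section Admissible.
Variable R : realType.
Implicit Types (c : R -> R) (p : R) (Z : set R) (C K X : set (R * R)).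

Definition region c1 c2 : set (R * R) :=
  [set x | c1 x.2 < x.1 < c2 x.2].

Definition level X p : set (R * R) := X `&` [set x | x.1 = p].

(* A contour is nonempty, as the component of one of its points; an empty
   level set has no contour. *)
Definition contour_at X p C : Prop :=
  exists2 x, level X p x & C = connected_component (level X p) x.

Definition contour X C : Prop := exists p, contour_at X p C.

Definition singular_points c1 c2 : set (R * R) :=
  [set (c1 t, t) | t in critical_set c1] `|`
  [set (c2 t, t) | t in critical_set c2].

(* Distinct contours are disjoint, so the union over F is a disjoint one. *)
Definition isolating_neighborhood c1 c2 C K : Prop :=
  let X := closure (region c1 c2) in
  [/\ connected K,
      set_nbhs (C : set (subspace X)) K,
      exists2 F : set (set (R * R)), F `<=` contour X & K = \bigcup_(A in F) A,
      closed_in X K &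
      (K `\` C) `&` singular_points c1 c2 = set0].

Definition admissible Z c1 c2 : Prop :=
  [/\ closed Z /\ discrete_set Z,
      ts_function c1 /\ ts_function c2,
      forall x, c1 x < c2 x,
      let V := (c1 @` critical_set c1 `|` c2 @` critical_set c2) `&` ~` Z in
      discrete_set V /\ closed_in (~` Z) V &
      forall p C, Z p -> contour_at (closure (region c1 c2)) p C ->
        exists K, isolating_neighborhood c1 c2 C K].

Definition admissible_between (p1 p2 : R) c1 c2 : Prop :=
  admissible [set p1; p2] c1 c2 /\
  (p1 < p2 -> (range c1 = `]p1, p2[%classic) /\ (range c2 = `]p1, p2[%classic)) /\
  (p2 < p1 -> (range c1 = `]p2, p1[%classic) /\ (range c2 = `]p2, p1[%classic)).

End Admissible.

Section GlobalSimilarity.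
Variable R : realType.
Implicit Types (c : R -> R) (A B : set (R * R)) (a n v x : R * R).

Definition rotation a (t : R) x : R * R :=
  (a.1 + cos t * (x.1 - a.1) - sin t * (x.2 - a.2),
   a.2 + sin t * (x.1 - a.1) + cos t * (x.2 - a.2)).

(* The mirror is the line through a orthogonal to the nonzero vector n. *)
Definition reflection a n x : R * R :=
  let k := 2 * ((x.1 - a.1) * n.1 + (x.2 - a.2) * n.2) / (n.1 ^+ 2 + n.2 ^+ 2) in
  (x.1 - k * n.1, x.2 - k * n.2).

Definition translation v x : R * R := (x.1 + v.1, x.2 + v.2).

Inductive rigid_motion : (R * R -> R * R) -> Prop :=
| rigid_rotation a t : rigid_motion (rotation a t)
| rigid_reflection a n : n <> (0, 0) -> rigid_motion (reflection a n)
| rigid_translation v : rigid_motion (translation v)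
| rigid_comp f g : rigid_motion f -> rigid_motion g -> rigid_motion (f \o g).

Definition congruent A B : Prop := exists2 f, rigid_motion f & f @` A = B.

Definition graph_of c : set (R * R) := [set (c t, t) | t in setT].

Definition globally_similar c d : Prop :=
  congruent (graph_of c) (graph_of d) \/
  exists c' d' p : R -> R,
    [/\ congruent (graph_of c) (graph_of c'),
        congruent (graph_of d) (graph_of d'),
        smooth p, bounded_fun p &
        forall t, d' t = c' t + p t].

End GlobalSimilarity.

(* Main.v *)
(** Put M(u) = u / (1 + u), s = e^t and u = k (s + b sin s) with k > 0 and b in
    {0, 1}; the curves are c = p + (q - p) M(u). Since s/3 < s + b sin s < 3s,
    M(u) stays in (0, 1) and tends to 0 and 1 at the two ends, so the values p
    and q are never attained and admissibility over them is vacuous. The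
    derivative of c is a nonzero multiple of 1 + b cos s: for b = 0 there is no
    critical point, and for b = 1 the critical points are t = ln (pi + 2 pi n),
    a set that is bounded below and unbounded above. Hence one pair of curves
    with b = 1 serves both the second and the third claim. Scaling k orders the
    curves, the direction depending on the sign of q - p.

    Analyticity: M(u), cos s, sin s and s generate an algebra closed under
    differentiation, and bounding degrees and coefficients along iterated
    derivatives gives |c^(n)| <= C A^n n! locally, so the Taylor series
    converges to c. *)
Require Import Defs.
From mathcomp Require Import ring lra.

Set Implicit Arguments.
Unset Strict Implicit.
Unset Printing Implicit Defensive.

Local Open Scope classical_set_scope.
Local Open Scope ring_scope.

(** * Analyticity from a finitely generated differential algebra *)

Section GradedBounds.
Variables (R : realType) (I : Type) (y : I -> R -> R).

(* [graded m a f]: f is a polynomial of degree at most m in the generators y i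
   whose coefficients have absolute values summing to at most a. *)
Inductive graded : nat -> R -> (R -> R) -> Prop :=
| graded_cst k : graded 0 `|k| (fun=> k)
| graded_gen i : graded 1 1 (y i)
| graded_add m a f b g :
    graded m a f -> graded m b g -> graded m (a + b) (fun t => f t + g t)
| graded_mul m a f n b g :
    graded m a f -> graded n b g -> graded (m + n) (a * b) (fun t => f t * g t)
| graded_weak m n a b f :
    (m <= n)%N -> a <= b -> graded m a f -> graded n b f.

Lemma graded_ge0 m a f : graded m a f -> 0 <= a.
Proof.
elim=> {m a f} //= [m a f b g _ + _|m a f n b g _ + _|m n a b f _ ab _ a0].
- exact: addr_ge0.
- exact: mulr_ge0.
- exact: le_trans ab.
Qed.

Lemma graded_bound (x B : R) m a f : 1 <= B -> (forall i, `|y i x| <= B) ->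
  graded m a f -> `|f x| <= a * B ^+ m.
Proof.
move=> B1 yB; have B0 : 0 <= B by lra.
elim=> {m a f} //= [k|i|m a f b g _ hf _ hg|m a f n b g Hf hf Hg hg
  |m n a b f mn ab Hf hf].
- by rewrite expr0 mulr1.
- by rewrite expr1 mul1r.
- by rewrite mulrDl (le_trans (ler_normD _ _))// lerD.
- by rewrite normrM exprD mulrACA ler_pM.
- have a0 := graded_ge0 Hf; apply: le_trans hf _; apply: ler_pM => //.
    exact: exprn_ge0.
  exact: ler_weXn2l.
Qed.

Variables (d : nat) (N : R).
Hypothesis N_ge0 : 0 <= N.
Hypothesis y_deriv : forall i, exists2 g, graded d.+1 N g &
  forall x : R, is_derive x 1 (y i) (g x).

(** By the Leibniz rule a monomial of degree at most [m] yields at most [m] terms, each with one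
    generator replaced by its derivative. That replacement raises the degree by at most [d] and
    multiplies the coefficient mass by at most [N]. *)
Lemma graded_deriv m a f : graded m a f -> exists2 g,
  graded (m + d) (m%:R * N * a) g & forall x : R, is_derive x 1 f (g x).
Proof.
elim=> {m a f} //= [k|i|m a f b g Hf [f' Hf' df] Hg [g' Hg' dg]
  |m a f n b g Hf [f' Hf' df] Hg [g' Hg' dg]|m n a b f mn ab Hf [f' Hf' df]].
- exists (fun=> 0) => [|x]; last exact: is_derive_cst.
  apply: graded_weak (graded_cst 0) => //; by rewrite normr0 !mul0r.
- by have [g Hg dg] := y_deriv i; exists g => //; rewrite mul1r mulr1 add1n.
- exists (fun t => f' t + g' t) => [|x]; last exact: is_deriveD.
  by rewrite mulrDr; exact: graded_add.
- exists (fun t => f t * g' t + g t * f' t) => [|x]; last exact: is_deriveM.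
  rewrite natrD (_ : _ * _ =
    a * (n%:R * N * b) + b * (m%:R * N * a)); last ring.
  apply: graded_add; first by rewrite -addnA; exact: graded_mul.
  by rewrite (addnC m) -addnA; exact: graded_mul.
- exists f' => //; apply: graded_weak Hf'; first by rewrite leq_add2r.
  have a0 := graded_ge0 Hf.
  by apply: ler_pM => //;
    [exact: mulr_ge0|apply: ler_wpM2r => //; rewrite ler_nat].
Qed.

(** The degree after k derivatives is at most k d + 1, so the masses gain the factors (k d + 1) N
    for k < n. Since k d + 1 <= (d + 1)(k + 1), their product is at most ((d + 1) N)^n n!. *)
Lemma graded_derive1n a f n : graded 1 a f ->
  graded (n * d).+1 (a * (d.+1%:R * N) ^+ n * n`!%:R) (derive1n n f).
Proof.
move=> Hf; elim: n => [|n ih]; first by rewrite mul0n expr0 !mulr1.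
have [g Hg dg] := graded_deriv ih.
have -> : derive1n n.+1 f = g.
  by apply/funext => x; rewrite derive1nS derive1E; have [_ ->] := dg x.
apply: graded_weak Hg; first by rewrite mulSn addnC addnS.
have a0 := graded_ge0 Hf.
rewrite factS natrM exprS.
rewrite [leRHS](_ : _ = (d.+1%:R * n.+1%:R) * N *
  (a * (d.+1%:R * N) ^+ n * n`!%:R)); last ring.
apply: ler_wpM2r; first by rewrite !mulr_ge0// exprn_ge0// mulr_ge0.
apply: ler_wpM2r => //; rewrite -natrM ler_nat mulSn mulnS addnA.
by rewrite (mulnC d) addSn addSn ltnS leq_addl.
Qed.

Lemma graded_smooth a f : graded 1 a f -> smooth f.
Proof.
move=> Hf n x; have [g _ dg] := graded_deriv (graded_derive1n n Hf).
by have [] := dg x.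
Qed.

(** A bound [B] on the generators at a point turns the degree n d + 1 into the factor B (B^d)^n,
    leaving an estimate of the form C A^n n!. *)
Lemma graded_derive1n_bound a f (x B : R) n : graded 1 a f -> 1 <= B ->
  (forall i, `|y i x| <= B) ->
  `|derive1n n f x| <= (a * B) * (d.+1%:R * N * B ^+ d) ^+ n * n`!%:R.
Proof.
move=> Hf B1 yB; apply: le_trans (graded_bound B1 yB (graded_derive1n n Hf)) _.
rewrite exprS mulnC exprM [in leRHS]exprMn le_eqVlt; apply/orP; left; apply/eqP.
ring.
Qed.

End GradedBounds.

(** * Convergence of Taylor series under factorial derivative bounds *)

Section Taylor.
Variable R : realType.
Implicit Types (f : R -> R) (x t : R).

Lemma eq_is_derive f g x a b : is_derive x 1 f a -> f =1 g -> a = b ->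
  is_derive x 1 g b.
Proof. by move=> df /funext <- <-. Qed.

Lemma smooth_is_derive f n x : smooth f ->
  is_derive x 1 (derive1n n f) (derive1n n.+1 f x).
Proof. by move=> sf; rewrite derive1nS derive1E; apply: derivableP. Qed.

(* The value at x as a function of the centre t, so that its derivative
   telescopes. *)
Definition taylor f n x : R -> R :=
  fun t => \sum_(i < n) derive1n i f t / i`!%:R * (x - t) ^+ i.

Lemma is_derive_taylor f n x t : smooth f ->
  is_derive t 1 (taylor f n.+1 x) (derive1n n.+1 f t / n`!%:R * (x - t) ^+ n).
Proof.
move=> sf; rewrite /taylor; elim: n => [|n ih].
  rewrite expr0 mulr1 fact0 divr1.
  rewrite (_ : (fun _ => _) = f); first exact: (smooth_is_derive 0).
  by apply/funext => u; rewrite big_ord1 expr0 mulr1 divr1.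
have d1 := smooth_is_derive n.+1 t sf.
have dp : is_derive t 1 (fun u : R => (x - u) ^+ n.+1)
    (- n.+1%:R * (x - t) ^+ n).
  have d0 : is_derive t 1 (fun u : R => x - u) (0 - 1).
    exact: is_deriveB.
  have dX := is_deriveX n.+1 d0.
  rewrite exprfctE in dX.
  apply: (is_derive_eq dX).
  by rewrite /GRing.scale /= sub0r mulrN1 mulNr mulr_natl.
have dm := is_deriveM d1 dp.
apply: (eq_is_derive (is_deriveD ih (is_deriveZ n.+1`!%:R^-1 dm))) => [u|].
  rewrite big_ord_recr /=; congr (_ + _).
  by rewrite -derive1nS [RHS]mulrAC [RHS]mulrC.
rewrite /GRing.scale /=.
rewrite factS natrM.
have nf : n`!%:R != 0 :> R by rewrite pnatr_eq0 -lt0n fact_gt0.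
have n1 : n.+1%:R != 0 :> R by rewrite pnatr_eq0.
by field; rewrite nat1r nf n1.
Qed.

(** Cauchy form of the remainder: the mean value theorem is applied to the Taylor polynomial as a
    function of its centre, which takes the value f(x) at the centre x. The factor n + 1 is (n + 1)!
    / n!. *)
Lemma taylor_remainder f n (x0 x C A : R) : smooth f -> 0 <= C -> 0 <= A ->
  (forall t, `|t - x0| <= `|x - x0| ->
    `|derive1n n.+1 f t| <= C * A ^+ n.+1 * n.+1`!%:R) ->
  `|f x - taylor f n.+1 x x0| <= C * n.+1%:R * (A * `|x - x0|) ^+ n.+1.
Proof.
move=> sf C0 A0 fb.
have Tx : taylor f n.+1 x x = f x.
  rewrite /taylor big_ord_recl /= expr0 mulr1 fact0 divr1 big1 ?addr0// => i _.
  by rewrite subrr expr0n /= mulr0.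
pose D t := derive1n n.+1 f t / n`!%:R * (x - t) ^+ n.
have dT t : is_derive t 1 (taylor f n.+1 x) (D t) by exact: is_derive_taylor.
have cT (i : interval R) : {within [set` i], continuous (taylor f n.+1 x)}.
  by apply: derivable_within_continuous => t _; have [] := dT t.
have [z [zx0 zx] ->] :
    exists2 z, `|z - x0| <= `|x - x0| /\ `|x - z| <= `|x - x0| &
    f x - taylor f n.+1 x x0 = D z * (x - x0).
  rewrite -Tx; case: (leP x0 x) => xx0.
    have [z] := MVT_segment xx0 (fun t _ => dT t) (cT _).
    rewrite in_itv /= => /andP[z1 z2] ->; exists z => //.
    by rewrite !ger0_norm ?subr_ge0//; split; lra.
  have [z] := MVT_segment (ltW xx0) (fun t _ => dT t) (cT _).
  rewrite in_itv /= => /andP[z1 z2] e; exists z; last by lra.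
  by rewrite !ler0_norm ?subr_le0// ?(ltW xx0)//; split; lra.
rewrite /D !normrM normrX normfV (ger0_norm (ler0n _ _)).
have nf : 0 < n`!%:R :> R by rewrite ltr0n fact_gt0.
rewrite exprMn (exprSr `|x - x0|) factS natrM in fb *.
rewrite [leRHS](_ : _ = (C * A ^+ n.+1 * (n.+1%:R * n`!%:R)) / n`!%:R *
    `|x - x0| ^+ n * `|x - x0|); last first.
  by field; rewrite gt_eqF.
apply: ler_wpM2r => //; apply: ler_pM => //.
- by apply: ler_wpM2r; [rewrite invr_ge0 ltW|exact: fb].
- by apply: lerXn2r; rewrite ?nnegrE.
Qed.

Lemma real_analytic_of_bounds f : smooth f ->
  (forall x0, exists C A : R, [/\ 0 <= C, 0 < A & forall t n, `|t - x0| < 1 ->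
     `|derive1n n f t| <= C * A ^+ n * n`!%:R]) ->
  real_analytic f.
Proof.
move=> sf fb x0; have [C [A [C0 A0 fCA]]] := fb x0.
exists (fun n => derive1n n f x0 / n`!%:R).
(* The cap 1 keeps the segment where the derivative bounds hold; 1 / (4 A) makes A |x - x0| <= 1/4,
   with room to absorb the factor n + 1. *)
exists (Num.min 1 (4 * A)^-1).
  by rewrite lt_min ltr01 invr_gt0 mulr_gt0.
move=> x; rewrite lt_min => /andP[x1 xA].
have Ax : A * `|x - x0| <= 4^-1.
  have : 4 * A * `|x - x0| <= 1.
    by rewrite -ler_pdivlMl ?mulr_gt0// mulr1 ltW.
  lra.
have Ax0 : 0 <= A * `|x - x0| by rewrite mulr_ge0// ltW.
rewrite -cvg_shiftS.
apply/cvgrPdist_le => e e0; near=> n.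
rewrite (_ : [sequence pseries _ _ _]_n n = taylor f n.+1 x x0); last first.
  by rewrite /pseries /series /= big_mkord.
apply: le_trans
  (taylor_remainder (C := C) (A := A) sf C0 (ltW A0) _) _ => [t tx|].
  by apply: fCA; exact: le_lt_trans x1.
apply: (@le_trans _ _ (C * 2^-1 ^+ n.+1)).
  rewrite -mulrA; apply: ler_wpM2l => //.
  (* Since n + 1 <= 2^(n + 1), the remainder is dominated by a geometric sequence of ratio 1/2. *)
  apply: (@le_trans _ _ (2 ^+ n.+1 * 4^-1 ^+ n.+1)); last first.
    rewrite -exprMn (_ : 2 * 4^-1 = 2^-1)//; lra.
  apply: ler_pM => //; first exact: exprn_ge0.
    by rewrite -natrX ler_nat ltnW// ltn_expl.
  by apply: lerXn2r; rewrite ?nnegrE.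
near: n.
have /(cvg_geometric C) : `|2^-1 : R| < 1 by rewrite ger0_norm; lra.
rewrite -cvg_shiftS /geometric /=.
move=> /cvgrPdist_le/(_ e e0); apply: filterS => n; rewrite sub0r normrN.
by rewrite ger0_norm// mulr_ge0// exprn_ge0// invr_ge0.
Unshelve. all: by end_near. Qed.

End Taylor.

(** * Admissibility of curves with discrete critical sets *)

Section Admissibility.
Variable R : realType.
Implicit Types (f c : R -> R) (p v : R) (S V X : set R).

Lemma finite_closed S : finite_set S -> closed S.
Proof.
exact: (accessible_finite_set_closed.1 (hausdorff_accessible (@Rhausdorff R))).
Qed.

Lemma finite_punctured_nbhs S v : finite_set S -> nbhs v (~` (S `\ v)).
Proof.
move=> fS; apply: open_nbhs_nbhs; split; last by case=> _; exact.
by apply: closed_openC; apply: finite_closed; exact: finite_setD.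
Qed.

Lemma locally_finite_discrete_closed X V : V `<=` X ->
  (forall v, X v -> exists2 U, nbhs v U & finite_set (U `&` V)) ->
  discrete_set V /\ closed_in X V.
Proof.
move=> VX lf; split.
  move=> v Vv; have [U Uv fUV] := lf v (VX v Vv).
  split; first exact: mem_set.
  exists (U `&` ~` ((U `&` V) `\ v)).
    by apply: filterI => //; exact: finite_punctured_nbhs.
  apply/seteqP; split=> [x [[Ux /not_andP xV] Vx]|x ->].
    by case: xV => [[]//|/contrapT].
  by split=> //; split; [exact: nbhs_singleton|case=> _; exact].
split=> //; apply/closed_subspaceP; exists (closure V).
  exact: closed_closure.
apply/seteqP; split=> x [Vx Xx]; split=> //; last exact: subset_closure.
have [U Ux fUV] := lf x Xx; apply: contrapT => nVx.
have [y [Vy [Uy []]]] := Vx _ (filterI Ux (finite_punctured_nbhs x fUV)).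
by split=> // yx; apply: nVx; rewrite -yx.
Qed.

(** The singletons of the critical points serve as pieces. *)
Lemma countable_ts_function c : smooth c -> countable (critical_set c) ->
  ts_function c.
Proof.
move=> sc cS; split=> //; exists [set [set x] | x in critical_set c]; split.
- exact: sub_countable (card_image_le _ _) cS.
- move=> _ _ [x _ <-] [y _ <-] [z [/= zx zy]].
  by rewrite -zx -zy.
- by move=> _ [x _ <-]; constructor 1; exists x.
- apply/seteqP; split=> [x Sx|x [_ [y Sy <-] ->//]].
  by exists [set x] => //; exists x.
Qed.

Lemma smooth_continuous c : smooth c -> continuous c.
Proof.
move=> sc x; apply/differentiable_continuous/derivable1_diffP; exact: (sc 0).
Qed.

Lemma range_of_continuous f p q : continuous f -> (forall x, p < f x < q) ->
  (forall y, p < y -> exists x, f x < y) ->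
  (forall y, y < q -> exists x, y < f x) -> range f = `]p, q[%classic.
Proof.
move=> cf fpq lof hif; apply/seteqP; split=> [_ [x _ <-]|y].
  by rewrite /= in_itv /=.
rewrite /= in_itv /= => /andP[py yq].
have [a ay] := lof y py; have [b yb] := hif y yq.
have fy : Num.min (f a) (f b) <= y <= Num.max (f a) (f b).
  by rewrite ge_min (ltW ay) le_max (ltW yb) orbT.
have [ab|ba] := leP a b.
  have [c _ <-] := IVT ab (continuous_subspaceT cf) fy; by exists c.
rewrite minC maxC in fy.
by have [c _ <-] := IVT (ltW ba) (continuous_subspaceT cf) fy; exists c.
Qed.

Lemma near_infty_bounded (P : R -> Prop) :
  (\forall x \near -oo, P x) -> (\forall x \near +oo, P x) ->
  exists M, forall x, ~ P x -> `|x| <= M.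
Proof.
move=> [M1 [_ h1]] [M2 [_ h2]]; exists (`|M1| + `|M2|) => x nPx.
have M1x : M1 <= x by rewrite leNgt; apply/negP => xM; exact/nPx/h1.
have xM2 : x <= M2 by rewrite leNgt; apply/negP => xM; exact/nPx/h2.
have := ler_norm (- M1); have := ler_norm M2; rewrite normrN ler_norml.
have := normr_ge0 M1; have := normr_ge0 M2; lra.
Qed.

(** Near both ends f is close to [p] or [q], hence away from v, so only a bounded part of [S] can be
    mapped near v. *)
Lemma locally_finite_image f S p q v :
  f x @[x --> -oo] --> p -> f x @[x --> +oo] --> q ->
  (forall M : R, finite_set (S `&` [set x | `|x| <= M])) -> v <> p -> v <> q ->
  exists2 U, nbhs v U & finite_set (U `&` f @` S).
Proof.
move=> fp fq lfS /eqP vp /eqP vq.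
(* With half the distances, a value within [e] of a limit cannot also be within [e] of v, by the
   triangle inequality. *)
pose e := Num.min (`|p - v| / 2) (`|q - v| / 2).
have e0 : 0 < e.
  by rewrite lt_min !divr_gt0 ?normr_gt0 ?subr_eq0// eq_sym.
have near_far r (F : set_system R) : Filter F -> f x @[x --> F] --> r ->
    e <= `|r - v| / 2 -> F [set x | ~ ball v e (f x)].
  move=> FF /cvgrPdist_lt fr er; apply: filterS (fr _ e0) => x /= rx vx.
  have := ler_distD (f x) r v; rewrite (distrC (f x)).
  rewrite /ball /= in vx; lra.
have [M bM] : exists M, forall x, ~ ~ ball v e (f x) -> `|x| <= M.
  apply: near_infty_bounded; apply: near_far.
  - exact: fp.
  - by rewrite ge_min lexx.
  - exact: fq.
  - by rewrite ge_min lexx orbT.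
exists (ball v e); first exact: nbhsx_ballx.
apply: (sub_finite_set _ (finite_image f (lfS M))).
move=> y [vy [x Sx fx]]; rewrite -fx in vy *.
by exists x => //; split=> //; apply: bM => /(_ vy).
Qed.

Lemma closure_region_le c1 c2 : continuous c1 -> continuous c2 ->
  closure (region c1 c2) `<=` [set x | c1 x.2 <= x.1 <= c2 x.2].
Proof.
move=> cc1 cc2.
have cl (f g : R * R -> R) : continuous f -> continuous g ->
    closed [set x | f x <= g x].
  move=> cf cg; rewrite (_ : mkset _ = (g \- f) @^-1` [set t | 0 <= t]).
    apply: preimage_closed; last exact: closed_ge.
    by move=> x _; apply: cvgB; [exact: cg|exact: cf].
  by apply/seteqP; split=> x /=; rewrite subr_ge0.
have c_snd c : continuous c -> continuous (fun x : R * R => c x.2).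
  by move=> cc x; apply: continuous_comp; [exact: cvg_snd|exact: cc].
have c_fst : continuous (fun x : R * R => x.1) by move=> x; exact: cvg_fst.
have cD : closed [set x : R * R | c1 x.2 <= x.1 <= c2 x.2].
  rewrite (_ : mkset _ = [set x | c1 x.2 <= x.1] `&` [set x | x.1 <= c2 x.2]).
    by apply: closedI; apply: cl => //; exact: c_snd.
  by apply/seteqP; split=> x /= => [/andP[]|[-> ->]].
rewrite [X in _ `<=` X](closure_id _).1//; apply: closureS.
by move=> x /andP[h1 h2]; rewrite /= !ltW.
Qed.

(* The boundary values are never attained, so the level sets over them are
   empty and the neighborhood condition is vacuous. *)
Lemma admissible_betweenP p1 p2 c1 c2 : p1 <> p2 -> smooth c1 -> smooth c2 ->
  (forall x, c1 x < c2 x) ->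
  (forall c, c = c1 \/ c = c2 ->
    [/\ forall x, Num.min p1 p2 < c x < Num.max p1 p2,
        c x @[x --> -oo] --> p1, c x @[x --> +oo] --> p2,
        countable (critical_set c) &
        forall M : R, finite_set (critical_set c `&` [set x | `|x| <= M])]) ->
  admissible_between p1 p2 c1 c2.
Proof.
move=> p12 s1 s2 c12 H.
have [b1 l1 r1 k1 f1] := H _ (or_introl erefl).
have [b2 l2 r2 k2 f2] := H _ (or_intror erefl).
have cc1 := smooth_continuous s1; have cc2 := smooth_continuous s2.
have rng c : c = c1 \/ c = c2 ->
    range c = `]Num.min p1 p2, Num.max p1 p2[%classic.
  move=> hc; have [b l r _ _] := H _ hc.
  have cc : continuous c by case: hc => ->.
  apply: range_of_continuous => // y.
    (* Being above the minimum means being above one of the two limits; f drops below y near the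
       corresponding end. *)
    rewrite gt_min => /orP[] hy.
      by apply: filter_ex (cvgr_lt _ l _ hy).
    by apply: filter_ex (cvgr_lt _ r _ hy).
  rewrite lt_max => /orP[] hy.
    by apply: filter_ex (cvgr_gt _ l _ hy).
  by apply: filter_ex (cvgr_gt _ r _ hy).
split; last first.
  rewrite !rng; [|by right|by left].
  by split=> h; rewrite ?(min_idPl (ltW h)) ?(min_idPr (ltW h))
    ?(max_idPl (ltW h)) ?(max_idPr (ltW h)).
have fZ : finite_set [set p1; p2] by rewrite finite_setU.
split=> //.
- split; first exact: finite_closed.
  have [] // := @locally_finite_discrete_closed setT [set p1; p2] _ _.
  move=> v _; exists setT; first exact: filterT.
  by rewrite setTI.
- by split; exact: countable_ts_function.
- apply: locally_finite_discrete_closed; first by move=> v [].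
  move=> v /not_orP[vp1 vp2].
  have [U1 U1v fU1] := locally_finite_image l1 r1 f1 vp1 vp2.
  have [U2 U2v fU2] := locally_finite_image l2 r2 f2 vp1 vp2.
  exists (U1 `&` U2); first exact: filterI.
  apply: (@sub_finite_set _ _ ((U1 `&` c1 @` critical_set c1) `|`
    (U2 `&` c2 @` critical_set c2))).
    by move=> y [[y1 y2] [[h|h] _]]; [left|right].
  by rewrite finite_setU.
- move=> p C Zp [x [/(closure_region_le cc1 cc2) /= /andP[h1 h2] xp] _].
  have /andP[g1 _] := b1 x.2; have /andP[_ g2] := b2 x.2.
  have /andP[] : Num.min p1 p2 < p < Num.max p1 p2.
    by rewrite -xp (lt_le_trans g1)//= (le_lt_trans h2).
  by case: Zp => ->; have [?|?] := ltP p1 p2; lra.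
Qed.

End Admissibility.

(** * Global similarity of bounded curves *)

Section SmoothDifference.
Variable R : realType.
Implicit Types f g c d : R -> R.

Lemma smoothB f g : smooth f -> smooth g -> smooth (f \- g).
Proof.
move=> sf sg; have E n : derive1n n (f \- g) = derive1n n f \- derive1n n g.
  elim: n => // n ih; apply/funext => x; rewrite derive1nS ih derive1E.
  by rewrite deriveB// /= -?derive1E ?derive1nS.
by move=> n x; rewrite E; apply: derivableB.
Qed.

(** Each graph is congruent to itself, and two functions with values in the same bounded interval
    differ by a bounded function. *)
Lemma globally_similar_of_bounds c d (m M : R) : smooth c -> smooth d ->
  (forall t, m < c t < M) -> (forall t, m < d t < M) -> globally_similar c d.
Proof.
move=> sc sd cb db; right; exists c, d, (d \- c).
have refl (A : set (R * R)) : congruent A A.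
  exists (translation (0, 0)); first exact: rigid_translation.
  rewrite (_ : translation _ = id) ?image_id//.
  by apply/funext => -[x y]; rewrite /translation /= !addr0.
split=> //; first exact: smoothB.
- exists (M - m); split=> [|B mMB t _ /=]; first exact: num_real.
  have /andP[] := cb t; have /andP[] := db t; rewrite ler_norml; lra.
- by move=> t; rewrite /= addrC subrK.
Qed.

End SmoothDifference.

(** * Where the cosine equals -1 *)

Section CosineMinimum.
Variable R : realType.

(** With n the number of full periods in s, the offset r = s - 2 pi n - pi lies in [-pi, pi] and has
    cosine 1. Injectivity of the cosine on [0, pi], applied to |r| and 0, gives r = 0. *)
Lemma cos_eqN1 (s : R) : 0 < s ->
  cos s = -1 <-> exists n : nat, s = pi + (pi *+ 2) *+ n.
Proof.
move=> s0; split=> [cs|[n ->]]; last by rewrite (periodicn (@cosD2pi R)) cospi.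
have pi0 := pi_gt0 R; have pp : 0 < pi *+ 2 :> R by rewrite mulrn_wgt0.
pose n := Num.truncn (s / (pi *+ 2)); exists n.
have /truncn_itv/andP[n1 n2] : 0 <= s / (pi *+ 2) by rewrite divr_ge0 ?ltW.
rewrite ler_pdivlMr// mulr_natl in n1.
rewrite ltr_pdivrMr// mulr_natl mulrS in n2.
pose r := s - (pi *+ 2) *+ n - pi.
suff : `|r| = 0 by move/eqP; rewrite normr_eq0 /r => /eqP; lra.
have rpi : `|r| <= pi.
  rewrite /r ler_norml; apply/andP; rewrite mulr2n in n1 n2 *; split; lra.
apply: cos_inj; rewrite ?in_itv /= ?normr_ge0 ?rpi ?lexx ?pi_ge0//.
rewrite cos_norm cos0 /r cosB cospi sinpi mulr0 addr0 mulrN1.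
by rewrite -(periodicn (@cosD2pi R) n) subrK cs opprK.
Qed.

End CosineMinimum.

(** * The oscillating curves *)

Section Limits.
Variable R : realType.

Lemma cvg_expR_ninfty : @expR R x @[x --> -oo] --> 0.
Proof. exact/cvgNy_compNP/cvgr_expR. Qed.

Lemma cvg_dist_le_mul (F : set_system R) (f g : R -> R) (l C : R) :
  Filter F -> 0 <= C -> (forall x, `|l - f x| <= C * g x) ->
  g x @[x --> F] --> 0 -> f x @[x --> F] --> l.
Proof.
move=> FF C0 fg /cvgrPdist_le g0; apply/cvgrPdist_le => e e0.
have C1 : 0 < C + 1 by lra.
(* Dividing by C + 1 instead of C covers the case C = 0. *)
apply: filterS (g0 (e / (C + 1)) (divr_gt0 e0 C1)) => x.
rewrite sub0r normrN ler_pdivlMr// => gx.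
have h1 := fg x.
have h2 : C * g x <= C * `|g x| by rewrite ler_wpM2l// ler_norm.
have := normr_ge0 (g x); nra.
Qed.

End Limits.

(** * Bounds and derivative of the profile *)

Section WaveProfile.
Variable R : realType.
Implicit Types (b : bool) (k s t p d : R).

Definition wave k b t : R := k * (expR t + b%:R * sin (expR t)).

Definition profile k b t : R := wave k b t / (1 + wave k b t).

Lemma sin_le s : 0 <= s -> sin s <= s.
Proof.
move=> s0.
have cs (i : interval R) : {within [set` i], continuous (@sin R)}.
  by apply: derivable_within_continuous => t _; exact: derivable_sin.
have [z _] := MVT_segment s0 (fun t _ => is_derive_sin t) (cs _).
by rewrite sin0 !subr0 => ->; rewrite -[leRHS]mul1r ler_wpM2r// cos_le1.
Qed.

(** For s <= 2 <= pi the sine is nonnegative; for s > 2 the estimate s - 1 > s/3 suffices. From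
    above, sin s <= s gives 2s. *)
Lemma add_sin_bounds b s : 0 < s -> 3^-1 * s < s + b%:R * sin s < 3 * s.
Proof.
move=> s0; have s_ge0 := ltW s0; have := sin_le s_ge0.
case: b; rewrite ?mul0r ?mul1r; last by lra.
move=> h; apply/andP; split; last by lra.
have [s2|s2] := lerP s 2.
  suff : 0 <= sin s by lra.
  by apply: sin_ge0_pi; rewrite s_ge0 (le_trans s2)// pi_ge2.
have := sin_geN1 s; lra.
Qed.

Lemma wave_bounds k b t : 0 < k ->
  3^-1 * (k * expR t) < wave k b t < 3 * (k * expR t).
Proof.
move=> k0; have /andP[h1 h2] := add_sin_bounds b (expR_gt0 t).
by rewrite /wave !(mulrCA _ k) !ltr_pM2l// h1.
Qed.

Lemma wave_gt0 k b t : 0 < k -> 0 < wave k b t.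
Proof.
move=> k0; have /andP[h _] := wave_bounds b t k0.
apply: lt_trans h; by rewrite !mulr_gt0// ?invr_gt0// expR_gt0.
Qed.

Lemma wave1_neq0 k b t : 0 < k -> 1 + wave k b t != 0.
Proof. by move=> k0; rewrite gt_eqF// addr_gt0// wave_gt0. Qed.

Lemma onem_profile k b t : 0 < k -> 1 - profile k b t = (1 + wave k b t)^-1.
Proof. by move=> k0; rewrite /profile; field; exact: wave1_neq0. Qed.

Lemma profile_gt0 k b t : 0 < k -> 0 < profile k b t.
Proof.
move=> k0; have w0 := wave_gt0 b t k0.
by rewrite /profile divr_gt0// addr_gt0.
Qed.

Lemma profile_lt1 k b t : 0 < k -> profile k b t < 1.
Proof.
move=> k0; rewrite -subr_gt0 onem_profile// invr_gt0.
by have := wave_gt0 b t k0; lra.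
Qed.

Lemma profile_lt k l a b t : 0 < k -> 0 < l -> wave k a t < wave l b t ->
  profile k a t < profile l b t.
Proof.
move=> k0 l0 w; suff : 1 - profile l b t < 1 - profile k a t by lra.
rewrite !onem_profile// ltf_pV2 ?posrE ?ltrD2l//.
- by have := wave_gt0 b t l0; lra.
- by have := wave_gt0 a t k0; lra.
Qed.

(** Serves the limit at minus infinity, through M(u) <= u. *)
Lemma profile_le_exp k b t : 0 < k -> profile k b t <= 3 * k * expR t.
Proof.
move=> k0; have w0 := wave_gt0 b t k0; have /andP[_ h] := wave_bounds b t k0.
rewrite /profile ler_pdivrMr; last by lra.
have : 0 <= 3 * k * expR t * wave k b t.
  by rewrite ltW// mulr_gt0// !mulr_gt0// expR_gt0.
rewrite mulrDr mulr1; lra.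
Qed.

(** Serves the limit at plus infinity, through 1 - M(u) = 1 / (1 + u) <= 1 / u. *)
Lemma onem_profile_le_exp k b t : 0 < k ->
  1 - profile k b t <= 3 / k * expR (- t).
Proof.
move=> k0; rewrite onem_profile//.
have w0 := wave_gt0 b t k0; have /andP[h _] := wave_bounds b t k0.
have e0 := expR_gt0 t.
rewrite expRN (_ : _ * _ = (3^-1 * (k * expR t))^-1); last first.
  by field; rewrite !gt_eqF.
rewrite lef_pV2 ?posrE; first by lra.
- lra.
- by rewrite !mulr_gt0// ?invr_gt0.
Qed.

Lemma is_derive_wave k b t :
  is_derive t 1 (wave k b) (k * (1 + b%:R * cos (expR t)) * expR t).
Proof.
have ds : is_derive t 1 (fun u : R => sin (expR u)) (cos (expR t) * expR t).
  exact: (is_derive1_comp (is_derive_sin _) (is_derive_expR _)).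
apply: (eq_is_derive (is_deriveZ k
  (is_deriveD (is_derive_expR t) (is_deriveZ b%:R ds)))) => //.
rewrite /GRing.scale /=; ring.
Qed.

(** Since M'(u) = 1 / (1 + u)^2 = (1 - M(u))^2, the derivative is a polynomial in the profile
    itself, cos s and s, with no quotient left. *)
Lemma is_derive_profile k b t : 0 < k -> is_derive t 1 (profile k b)
  (k * (1 - profile k b t) ^+ 2 * (1 + b%:R * cos (expR t)) * expR t).
Proof.
move=> k0; have w1 := wave1_neq0 b t k0.
have d1 : is_derive t 1 (fun u => 1 + wave k b u)
    (0 + k * (1 + b%:R * cos (expR t)) * expR t).
  apply: is_deriveD; exact: is_derive_wave.
have h := is_deriveB (is_derive_cst (1 : R) t 1)
  (is_deriveV (f := fun u => 1 + wave k b u) w1 d1).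
apply: (eq_is_derive h) => [u|].
  by rewrite -[RHS](subKr 1) onem_profile.
by rewrite onem_profile// /GRing.scale /=; field.
Qed.

End WaveProfile.

(** * The curves: analyticity, limits, critical points and order *)

Section WaveCurve.
Variable R : realType.
Implicit Types (b : bool) (k s t p q : R).

Definition wave_curve p q k b t : R := p + (q - p) * profile k b t.

Variant wave_generator := GenProfile | GenCos | GenSin | GenExp.

Definition wave_gen k b i : R -> R :=
  match i with
  | GenProfile => profile k b
  | GenCos => fun t => cos (expR t)
  | GenSin => fun t => sin (expR t)
  | GenExp => @expR R
  end.

(** The profile dictates the constants: k (1 - M)^2 (1 + b cos s) s has degree 4 and mass at most k
    * 4 * 2 = 8 k. The summand 1 covers the other three generators. *)
Lemma wave_gen_deriv k b : 0 < k -> forall i, exists2 g,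
  graded (wave_gen k b) 4 (1 + 8 * k) g &
  forall t : R, is_derive t 1 (wave_gen k b i) (g t).
Proof.
move=> k0; set G := wave_gen k b.
have g1D a f : graded G 1 a f -> graded G 1 (1 + a) (fun t => 1 + f t).
  move=> Hf; apply: graded_add => //.
  by apply: graded_weak (graded_cst G 1); rewrite ?normr1.
have gE : graded G 1 1 (@expR R) := graded_gen G GenExp.
have gC : graded G 1 1 (fun t => cos (expR t)) := graded_gen G GenCos.
have gS : graded G 1 1 (fun t => sin (expR t)) := graded_gen G GenSin.
have gV : graded G 1 1 (profile k b) := graded_gen G GenProfile.
have gW := graded_mul (graded_cst G (-1)) gV.
have k8 : 1 <= 1 + 8 * k by lra.
case=> /=.
(* The factor 1 - M is spelled with [1 + -1 *] to match the constructors of [graded]. *)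
- exists (fun t => k * ((1 + -1 * profile k b t) * (1 + -1 * profile k b t))
      * (1 + b%:R * cos (expR t)) * expR t) => [|t].
    have b1 (c : bool) : `|c%:R| <= 1 :> R by case: c; rewrite ?normr0 ?normr1.
    have := b1 b; have := normr_ge0 (b%:R : R) => b0 b01.
    apply: graded_weak (graded_mul (graded_mul (graded_mul (graded_cst G k)
      (graded_mul (g1D _ _ gW) (g1D _ _ gW)))
      (g1D _ _ (graded_mul (graded_cst G b%:R) gC))) gE) => //.
    rewrite normrN normr1 !mulr1 (gtr0_norm k0).
    nra.
  apply: (eq_is_derive (is_derive_profile b t k0)) => //; ring.
- exists (fun t => -1 * sin (expR t) * expR t) => [|t].
    apply: graded_weak
      (graded_mul (graded_mul (graded_cst G (-1)) gS) gE) => //.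
    by rewrite normrN normr1 !mulr1.
  apply: (eq_is_derive (is_derive1_comp (is_derive_cos _)
    (is_derive_expR t))) => //.
  by rewrite mulN1r.
- exists (fun t => cos (expR t) * expR t) => [|t].
    by apply: graded_weak (graded_mul gC gE) => //; rewrite mulr1.
  exact: (is_derive1_comp (is_derive_sin _) (is_derive_expR t)).
- exists (@expR R) => [|t]; last exact: is_derive_expR.
  exact: graded_weak gE.
Qed.

(** Profile, cosine and sine are at most 1 in absolute value; the exponential is at most its value
    at the right end x0 + 1. *)
Lemma wave_gen_bound k b x0 t : 0 < k -> `|t - x0| < 1 -> forall i,
  `|wave_gen k b i t| <= 1 + expR (x0 + 1).
Proof.
move=> k0 tx; have e0 := expR_gt0 (x0 + 1).
have e1 : 1 <= 1 + expR (x0 + 1) by lra.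
have pv := profile_gt0 b t k0; have pv1 := profile_lt1 b t k0.
case=> /=.
- by rewrite gtr0_norm//; lra.
- exact: le_trans (cos_max _) e1.
- exact: le_trans (sin_max _) e1.
- rewrite gtr0_norm ?expR_gt0// ler_wpDl// ler_expR.
  by move: tx; rewrite ltr_norml; lra.
Qed.

Lemma graded_wave_curve p q k b : graded (wave_gen k b) 1 (`|p| + `|q - p|)
  (wave_curve p q k b).
Proof.
apply: graded_add; first exact: graded_weak (graded_cst _ p).
apply: graded_weak (graded_mul (graded_cst _ (q - p))
  (graded_gen _ GenProfile)) => //.
by rewrite mulr1.
Qed.

Lemma wave_curve_smooth p q k b : 0 < k -> smooth (wave_curve p q k b).
Proof.
move=> k0; apply: (graded_smooth _ (wave_gen_deriv b k0)
  (graded_wave_curve p q k b)).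
lra.
Qed.

Lemma wave_curve_analytic p q k b : 0 < k -> real_analytic (wave_curve p q k b).
Proof.
move=> k0; apply: real_analytic_of_bounds; first exact: wave_curve_smooth.
move=> x0; pose B := 1 + expR (x0 + 1).
have B1 : 1 <= B by rewrite /B; have := expR_gt0 (x0 + 1); lra.
have N0 : 0 <= 1 + 8 * k by lra.
(* These are the constants of [graded_derive1n_bound] for d = 3 and N = 1 + 8 k. *)
exists ((`|p| + `|q - p|) * B), (4%:R * (1 + 8 * k) * B ^+ 3); split.
- by rewrite mulr_ge0 ?addr_ge0//; lra.
- by rewrite !mulr_gt0 ?exprn_gt0//; lra.
move=> t n tx; apply: (graded_derive1n_bound N0 (wave_gen_deriv b k0)) => //.
  exact: graded_wave_curve.
exact: wave_gen_bound.
Qed.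

Lemma wave_curve_bounds p q k b t : p <> q -> 0 < k ->
  Num.min p q < wave_curve p q k b t < Num.max p q.
Proof.
move=> pq k0; have := profile_gt0 b t k0; have := profile_lt1 b t k0.
rewrite /wave_curve; set v := profile k b t => v1 v0.
have [h|h] := ltP p q; first nra.
have h' : q < p by rewrite lt_neqAle h andbT eq_sym; apply/eqP.
nra.
Qed.

Lemma wave_curve_ninfty p q k b : 0 < k ->
  wave_curve p q k b x @[x --> -oo] --> p.
Proof.
move=> k0; apply: (@cvg_dist_le_mul R _ _ _ _ (`|q - p| * (3 * k)) _ _ _
  (@cvg_expR_ninfty R)).
  by rewrite mulr_ge0//; lra.
move=> x; rewrite /wave_curve opprD addNKr normrN normrM -mulrA ler_wpM2l//.
by rewrite gtr0_norm ?profile_gt0// profile_le_exp.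
Qed.

Lemma wave_curve_pinfty p q k b : 0 < k ->
  wave_curve p q k b x @[x --> +oo] --> q.
Proof.
move=> k0; apply: (@cvg_dist_le_mul R _ _ _ _ (`|q - p| * (3 / k)) _ _ _
  (@cvgr_expR R)).
  by rewrite mulr_ge0// divr_ge0// ltW.
move=> x; rewrite (_ : q - _ = (q - p) * (1 - profile k b x)); last first.
  by rewrite /wave_curve; ring.
rewrite normrM -mulrA ler_wpM2l// gtr0_norm ?onem_profile_le_exp//.
by rewrite subr_gt0 profile_lt1.
Qed.

Lemma critical_set_wave_curve p q k b : p <> q -> 0 < k ->
  critical_set (wave_curve p q k b) = [set t | b%:R * cos (expR t) = -1].
Proof.
move=> /eqP pq k0.
have dc t : is_derive t 1 (wave_curve p q k b) ((q - p) *
    (k * (1 - profile k b t) ^+ 2 * (1 + b%:R * cos (expR t)) * expR t)).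
  have d0 := is_deriveD (is_derive_cst p t 1)
    (is_deriveZ (q - p) (is_derive_profile b t k0)).
  by apply: (eq_is_derive d0) => //; rewrite /GRing.scale /= add0r.
apply/seteqP; split=> t /= h.
  have /eqP := etrans (esym (@derive_val _ _ _ _ _ _ _ (dc t)))
    (@derive_val _ _ _ _ _ _ _ h).
  (* Every factor of the derivative other than 1 + b cos s is nonzero. *)
  rewrite !mulf_eq0 subr_eq0 eq_sym (negPf pq) (gt_eqF k0).
  rewrite (gt_eqF (expR_gt0 t)) /=.
  rewrite subr_eq0 [1 == _]gt_eqF ?profile_lt1//= orbF addrC addr_eq0.
  by move=> /eqP.
by apply: (eq_is_derive (dc t)) => //; rewrite h; ring.
Qed.

Lemma critical_set_monotone_curve p q k : p <> q -> 0 < k ->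
  critical_set (wave_curve p q k false) = set0.
Proof.
move=> pq k0; rewrite critical_set_wave_curve//; apply/seteqP; split=> t //=.
rewrite mul0r; lra.
Qed.

Definition wave_critical (n : nat) : R := ln (pi + (pi *+ 2) *+ n).

Lemma expR_wave_critical n : expR (wave_critical n) = pi + (pi *+ 2) *+ n.
Proof.
by rewrite lnK// posrE ltr_wpDr ?pi_gt0// mulrn_wge0// mulrn_wge0// pi_ge0.
Qed.

Lemma critical_set_oscillating_curve p q k : p <> q -> 0 < k ->
  critical_set (wave_curve p q k true) = range wave_critical.
Proof.
move=> pq k0; rewrite critical_set_wave_curve//; apply/seteqP; split=> t /=.
  rewrite mul1r => /(cos_eqN1 (expR_gt0 t))[n tn]; exists n => //.
  by rewrite /wave_critical -tn expRK.
move=> [n _ <-]; rewrite mul1r; apply/(cos_eqN1 (expR_gt0 _)); exists n.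
exact: expR_wave_critical.
Qed.

(** A coarse growth rate that yields both local finiteness and unboundedness of the critical
    points. *)
Lemma expR_wave_critical_ge n : n%:R <= expR (wave_critical n).
Proof.
rewrite expR_wave_critical ler_wpDl ?pi_ge0// lerMn2r; apply/orP; right.
by have := pi_ge2 R; rewrite mulr2n; lra.
Qed.

Lemma critical_set_locally_finite p q k b (M : R) : p <> q -> 0 < k ->
  finite_set (critical_set (wave_curve p q k b) `&` [set x | `|x| <= M]).
Proof.
move=> pq k0; case: b; last by rewrite critical_set_monotone_curve// set0I.
rewrite critical_set_oscillating_curve//.
(* A critical point of index n in [-M, M] satisfies n <= e^M, which leaves finitely many indices. *)
apply: (sub_finite_set _ (finite_image wave_critical
  (finite_II (Num.truncn (expR M)).+1))).
move=> _ [[n _ <-] /= nM]; exists n => //=.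
have : n%:R <= expR M.
  apply: le_trans (expR_wave_critical_ge n) _; rewrite ler_expR.
  exact: le_trans (ler_norm _) nM.
by rewrite -truncn_ge_nat ?expR_ge0.
Qed.

Lemma critical_set_oscillating_has_lbound p q k : p <> q -> 0 < k ->
  has_lbound (critical_set (wave_curve p q k true)).
Proof.
(* This is the critical point of index 0. *)
move=> pq k0; exists (ln pi).
rewrite critical_set_oscillating_curve// => _ [n _ <-].
have ge0 : 0 <= (pi *+ 2) *+ n :> R by rewrite mulrn_wge0// mulrn_wge0// pi_ge0.
by rewrite ler_ln ?posrE ?lerDl ?pi_gt0// ltr_wpDr ?pi_gt0.
Qed.

Lemma critical_set_oscillating_has_ubound p q k : p <> q -> 0 < k ->
  ~ has_ubound (critical_set (wave_curve p q k true)).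
Proof.
move=> pq k0 [M]; rewrite critical_set_oscillating_curve// => hM.
have := hM (wave_critical (Num.truncn (expR M)).+1); rewrite -ler_expR leNgt.
rewrite (lt_le_trans (truncnS_gt (expR M)) (expR_wave_critical_ge _)).
by move=> /(_ (ex_intro2 _ _ _ I erefl)).
Qed.

Lemma critical_set_oscillating_unbounded p q k : p <> q -> 0 < k ->
  ~ bounded_set (critical_set (wave_curve p q k true)).
Proof.
move=> pq k0 [M [_ hM]]; apply: (critical_set_oscillating_has_ubound pq k0).
(* [bounded_set] provides a bound only for numbers strictly above [M]. *)
exists (M + 1) => x Sx; apply: le_trans (ler_norm x) (hM (M + 1) _ x Sx).
by rewrite ltrDl.
Qed.

Lemma admissible_between_wave_curve p q k l a b : p <> q -> 0 < k -> 0 < l ->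
  (forall t, wave_curve p q k a t < wave_curve p q l b t) ->
  admissible_between p q (wave_curve p q k a) (wave_curve p q l b).
Proof.
move=> pq k0 l0 lt.
have cc c m : 0 < m -> countable (critical_set (wave_curve p q m c)).
  case: c => m0; last by rewrite critical_set_monotone_curve.
  by rewrite critical_set_oscillating_curve//;
    exact: sub_countable (card_image_le _ _) _.
apply: admissible_betweenP => //; try exact: wave_curve_smooth.
by move=> _ [] ->; (split; [move=> t; exact: wave_curve_bounds
  |exact: wave_curve_ninfty|exact: wave_curve_pinfty|exact: cc
  |move=> M; exact: critical_set_locally_finite]).
Qed.

Lemma wave_curve_lt p q k l a b t : 0 < k -> 0 < l -> p < q ->
  wave k a t < wave l b t -> wave_curve p q k a t < wave_curve p q l b t.
Proof.
by move=> k0 l0 pq w; rewrite ltrD2l ltr_pM2l ?subr_gt0// profile_lt.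
Qed.

Lemma wave_curve_gt p q k l a b t : 0 < k -> 0 < l -> q < p ->
  wave l b t < wave k a t -> wave_curve p q k a t < wave_curve p q l b t.
Proof.
by move=> k0 l0 pq w; rewrite ltrD2l ltr_nM2l ?subr_lt0// profile_lt.
Qed.

Lemma wave_lt_scale k l b t : 0 < k -> k < l -> wave k b t < wave l b t.
Proof.
move=> k0 kl; have := wave_gt0 b t (k := 1) ltr01.
by rewrite /wave mul1r => w0; rewrite ltr_pM2r.
Qed.

(** The oscillating wave with k = 1 stays between s/3 and 3s, so the scales 1/4 and 4 leave strict
    room on either side. *)
Lemma wave_monotone_bounds t :
  wave 4^-1 false t < wave 1 true t < wave 4 false t.
Proof.
have := wave_bounds true t (@ltr01 R); have := expR_gt0 t.
rewrite [wave 4^-1 _ _]/wave [wave 4 _ _]/wave !mul0r !addr0; lra.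
Qed.

End WaveCurve.

Theorem theorem6 (R : realType) (p1 p2 : R) (p1_neq_p2 : p1 <> p2) :
  (exists c1 c2 : R -> R,
     [/\ real_analytic c1, real_analytic c2 & globally_similar c1 c2] /\
     [/\ admissible_between p1 p2 c1 c2,
         critical_set c1 = set0 /\ ~ bounded_set (critical_set c2),
         c1 x @[x --> -oo] --> p1 /\ c2 x @[x --> -oo] --> p1 &
         c1 x @[x --> +oo] --> p2 /\ c2 x @[x --> +oo] --> p2]) /\
  (exists c1 c2 : R -> R,
     [/\ real_analytic c1, real_analytic c2 & globally_similar c1 c2] /\
     [/\ admissible_between p1 p2 c1 c2,
         c1 x @[x --> -oo] --> p1 /\ c2 x @[x --> -oo] --> p1,
         c1 x @[x --> +oo] --> p2 /\ c2 x @[x --> +oo] --> p2 &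
         ~ bounded_set (critical_set c1) /\ ~ bounded_set (critical_set c2)]) /\
  (exists c1 c2 : R -> R,
     [/\ real_analytic c1, real_analytic c2 & globally_similar c1 c2] /\
     [/\ admissible_between p1 p2 c1 c2,
         c1 x @[x --> -oo] --> p1 /\ c2 x @[x --> -oo] --> p1,
         c1 x @[x --> +oo] --> p2 /\ c2 x @[x --> +oo] --> p2 &
         (has_lbound (critical_set c1) /\ ~ has_ubound (critical_set c1)) /\
         (has_lbound (critical_set c2) /\ ~ has_ubound (critical_set c2))]).
Proof.
have k1 : 0 < 1 :> R by []; have k2 : 0 < 2 :> R by [].
have k4 : 0 < 4 :> R by []; have kV4 : 0 < 4^-1 :> R by rewrite invr_gt0.
have similar k l a b : 0 < k -> 0 < l ->
    globally_similar (wave_curve p1 p2 k a) (wave_curve p1 p2 l b).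
  move=> k0 l0.
  apply: (@globally_similar_of_bounds _ _ _ (Num.min p1 p2) (Num.max p1 p2)).
  - exact: wave_curve_smooth.
  - exact: wave_curve_smooth.
  - by move=> t; exact: wave_curve_bounds.
  - by move=> t; exact: wave_curve_bounds.
have [k [k0 lt_k]] : exists k, 0 < k /\
    forall t, wave_curve p1 p2 k false t < wave_curve p1 p2 1 true t.
  have [p12|p21] := ltP p1 p2.
    exists 4^-1; split=> // t; apply: wave_curve_lt => //.
    by have /andP[] := wave_monotone_bounds t.
  (* For p2 < p1 the curve decreases as the wave grows, so the first curve takes the larger wave. *)
  exists 4; split=> // t; apply: wave_curve_gt => //.
    by rewrite lt_neqAle p21 andbT; apply/eqP => /esym.
  by have /andP[] := wave_monotone_bounds t.
have [l [m [l0 m0 lt_lm]]] : exists l m, [/\ 0 < l, 0 < m &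
    forall t, wave_curve p1 p2 l true t < wave_curve p1 p2 m true t].
  have lt12 : 1 < 2 :> R by rewrite ltr1n.
  have [p12|p21] := ltP p1 p2.
    exists 1, 2; split=> // t; apply: wave_curve_lt => //; exact: wave_lt_scale.
  exists 2, 1; split=> // t; apply: wave_curve_gt => //;
    last exact: wave_lt_scale.
  by rewrite lt_neqAle p21 andbT; apply/eqP => /esym.
split; [|split].
- exists (wave_curve p1 p2 k false), (wave_curve p1 p2 1 true).
  split; first by split; [exact: wave_curve_analytic..|exact: similar].
  split; first exact: admissible_between_wave_curve.
  + split; first exact: critical_set_monotone_curve.
    exact: critical_set_oscillating_unbounded.
  + by split; exact: wave_curve_ninfty.
  + by split; exact: wave_curve_pinfty.
- exists (wave_curve p1 p2 l true), (wave_curve p1 p2 m true).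
  split; first by split; [exact: wave_curve_analytic..|exact: similar].
  split; first exact: admissible_between_wave_curve.
  + by split; exact: wave_curve_ninfty.
  + by split; exact: wave_curve_pinfty.
  + by split; exact: critical_set_oscillating_unbounded.
- exists (wave_curve p1 p2 l true), (wave_curve p1 p2 m true).
  split; first by split; [exact: wave_curve_analytic..|exact: similar].
  split; first exact: admissible_between_wave_curve.
  + by split; exact: wave_curve_ninfty.
  + by split; exact: wave_curve_pinfty.
  + split; split; try exact: critical_set_oscillating_has_lbound;
      exact: critical_set_oscillating_has_ubound.
Qed.
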